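(* Let $\mathcal{Q}_n$ denote the $n$-dimensional hypercube graph. For a graph $F$, let $\mathrm{ex}_{\mathcal{Q}}(n,F)$ be the maximum number of edges of a subgraph of $\mathcal{Q}_n$ containing no (not necessarily induced) copy of $F$, and let $\pi_{\mathcal{Q}}(F)=\lim_{n\to\infty}\mathrm{ex}_{\mathcal{Q}}(n,F)/(n2^{n-1})$. Then $\pi_{\mathcal{Q}}(C_4)\le 0.6068$, where $C_4$ is the cycle of length $4$.
   Context: $\mathcal{Q}_n$ has vertex set $\{0,1\}^n$, two vertices being adjacent iff they differ in exactly one coordinate; it has $n2^{n-1}$ edges. The ratio $\mathrm{ex}_{\mathcal{Q}}(n,F)/(n2^{n-1})$ is non-increasing in $n$, so the limit $\pi_{\mathcal{Q}}(F)$ exists. *)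

(* Defs.v *)
From HB Require Import structures.
From mathcomp Require Import all_boot all_order all_algebra.
From mathcomp Require Import boolp classical_sets reals topology normedtype.
From mathcomp Require Import sequences.

Set Implicit Arguments.
Unset Strict Implicit.
Unset Printing Implicit Defensive.

Import Order.TTheory GRing.Theory Num.Theory.
Import numFieldNormedType.Exports.

Record sgraph := SGraph {
  vertex :> finType;
  adj : rel vertex;
  adj_sym : symmetric adj;
  adj_irr : irreflexive adj
}.

Definition edge_set (G : sgraph) : {set {set G}} :=
  [set e | [exists x, exists y, adj x y && (e == [set x; y])]].

(* A subgraph of G is encoded by its vertex set H.1 and its edge set H.2. *)
Definition is_subgraph (G : sgraph) (H : {set G} * {set {set G}}) : bool :=
  (H.2 \subset edge_set G) && [forall e in H.2, e \subset H.1].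

Definition has_copy (F G : sgraph) (H : {set G} * {set {set G}}) : bool :=
  [exists f : {ffun F -> G},
    [&& injectiveb f, [forall u, f u \in H.1] &
        [forall u, forall v, adj u v ==> ([set f u; f v] \in H.2)]]].

Definition ex_num (G F : sgraph) : nat :=
  \max_(H : {set G} * {set {set G}} | is_subgraph H && ~~ has_copy F H) #|H.2|.

Section Hypercube.
Variable n : nat.

Definition cube_adj : rel {ffun 'I_n -> bool} :=
  [rel x y : {ffun 'I_n -> bool} | #|[set i | x i != y i]| == 1].

Lemma cube_adj_sym : symmetric cube_adj.
Proof.
by move=> x y /=; congr (#|pred_of_set _| == _); apply/setP=> i; rewrite !inE eq_sym.
Qed.

Lemma cube_adj_irr : irreflexive cube_adj.
Proof.
by move=> x /=; apply/negP=> /cards1P[i /setP/(_ i)]; rewrite !inE !eqxx.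
Qed.

Definition hypercube : sgraph := SGraph cube_adj_sym cube_adj_irr.
End Hypercube.

Section Cycle.
Variable k : nat.

Definition cycle_adj : rel 'I_k :=
  [rel i j | (i != j) && ((j == ordS i) || (i == ordS j))].

Lemma cycle_adj_sym : symmetric cycle_adj.
Proof. by move=> i j; rewrite /cycle_adj /= eq_sym orbC. Qed.

Lemma cycle_adj_irr : irreflexive cycle_adj.
Proof. by move=> i; rewrite /cycle_adj /= eqxx. Qed.

(* The cycle of length k, for k >= 3. *)
Definition cycle_graph : sgraph := SGraph cycle_adj_sym cycle_adj_irr.
End Cycle.

Definition exQ (n : nat) (F : sgraph) : nat := ex_num (hypercube n) F.

Local Open Scope ring_scope.
Local Open Scope classical_set_scope.

Definition exQ_ratio (R : realType) (F : sgraph) (n : nat) : R :=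
  (exQ n F)%:R / (n * 2 ^ n.-1)%:R.

(* The limit exists for every F: see exQ_ratio_cvg below. *)
Definition piQ (R : realType) (F : sgraph) : R :=
  limn (exQ_ratio R F).

Local Close Scope classical_set_scope.
Local Close Scope ring_scope.

Section Averaging.
Variables (n : nat) (F : sgraph).
Notation Qn := (hypercube n).
Notation Qn1 := (hypercube n.+1).

Definition subcube (i : 'I_n.+1) (b : bool) (x : Qn) : Qn1 :=
  [ffun j => if unlift i j is Some k then x k else b].

Lemma subcube_lift i b x k : subcube i b x (lift i k) = x k.
Proof. by rewrite ffunE liftK. Qed.

Lemma subcube_inj i b : injective (subcube i b).
Proof.
by move=> x y exy; apply/ffunP=> k; rewrite -(subcube_lift i b x) exy subcube_lift.
Qed.

Definition restr (i : 'I_n.+1) (x : Qn1) : Qn := [ffun k => x (lift i k)].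

Lemma restrK i b (x : Qn1) : x i = b -> subcube i b (restr i x) = x.
Proof.
move=> xi; apply/ffunP=> j; rewrite !ffunE.
by case: unliftP => [k ->|->]; rewrite ?ffunE.
Qed.

Lemma restr_adj i b (x y : Qn1) :
  x i = b -> y i = b -> adj x y -> adj (restr i x) (restr i y).
Proof.
rewrite /adj /= /cube_adj /= => xi yi /eqP <-; apply/eqP.
rewrite -(card_imset _ (@lift_inj _ i)); congr #|pred_of_set _|.
apply/setP=> j; rewrite !inE; apply/imsetP/idP => [[k]|].
  by rewrite !inE !ffunE => xy ->.
by case: (unliftP i j) => [k ->|->] xy;
  [exists k; rewrite // !inE !ffunE | rewrite xi yi eqxx in xy].
Qed.

Definition pullback (i : 'I_n.+1) (b : bool) (H : {set Qn1} * {set {set Qn1}}) :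
    {set Qn} * {set {set Qn}} :=
  (subcube i b @^-1: H.1, [set e in edge_set Qn | subcube i b @: e \in H.2]).

Lemma pullback_subgraph i b H : is_subgraph H -> is_subgraph (pullback i b H).
Proof.
case/andP=> _ /forall_inP sub; apply/andP; split.
  by apply/fintype.subsetP=> e; rewrite inE => /andP[].
apply/forall_inP=> e; rewrite inE => /andP[_ eH].
apply/fintype.subsetP=> x xe; rewrite inE.
by apply: (fintype.subsetP (sub _ eH)); apply: imset_f.
Qed.

Lemma pullback_copy i b H :
  has_copy F (pullback i b H) -> has_copy F H.
Proof.
case/existsP=> f /and3P[/injectiveP finj /forallP fV /forallP fE].
apply/existsP; exists [ffun u => subcube i b (f u)]; apply/and3P; split.
- by apply/injectiveP=> u v; rewrite !ffunE => /subcube_inj /finj.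
- by apply/forallP=> u; rewrite ffunE; have := fV u; rewrite inE.
- apply/forallP=> u; apply/forallP=> v; apply/implyP=> uv; rewrite !ffunE.
  have /forallP/(_ v)/implyP/(_ uv) := fE u.
  by rewrite inE => /andP[_]; rewrite imsetU1 imset_set1.
Qed.

Definition in_subcube (p : 'I_n.+1 * bool) (e : {set Qn1}) :=
  [forall x in e, x p.1 == p.2].

Lemma card_pullback i b H : is_subgraph H ->
  #|[set e in H.2 | in_subcube (i, b) e]| <= #|(pullback i b H).2|.
Proof.
case/andP=> /fintype.subsetP HE _.
rewrite -(card_imset _ (imset_inj (@subcube_inj i b))).
apply/subset_leq_card/fintype.subsetP=> e; rewrite inE => /andP[eH /forall_inP ein].
have := HE _ eH; rewrite inE => /existsP[x /existsP[y /andP[xy /eqP exy]]].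
have xi : x i = b by apply/eqP/(ein x); rewrite exy !inE eqxx.
have yi : y i = b by apply/eqP/(ein y); rewrite exy !inE eqxx orbT.
have im : e = subcube i b @: [set restr i x; restr i y].
  by rewrite imsetU1 imset_set1 !restrK.
apply/imsetP; exists [set restr i x; restr i y] => //.
rewrite inE -im eH andbT inE; apply/existsP; exists (restr i x).
apply/existsP; exists (restr i y); apply/andP; split=> //; exact: (@restr_adj i b).
Qed.

Lemma card_in_subcube e : e \in edge_set Qn1 -> n <= #|[set p | in_subcube p e]|.
Proof.
rewrite inE => /existsP[x /existsP[y /andP[/= /cards1P[d dxy] /eqP ->]]].
have cd : #|[set~ d]| = n by rewrite cardsC1 card_ord.
have finj : injective (fun i : 'I_n.+1 => (i, x i)) by move=> i j [].
rewrite -[leqLHS]cd -(card_imset _ finj).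
apply/subset_leq_card/fintype.subsetP=> _ /imsetP[i id ->]; rewrite inE.
apply/forall_inP=> z; rewrite !inE => /orP[/eqP-> //|/eqP-> /=].
have : i \notin [set d] by move: id; rewrite !inE.
by rewrite -dxy inE negbK eq_sym.
Qed.

Lemma exQ_average : n * exQ n.+1 F <= 2 * n.+1 * exQ n F.
Proof.
have [->//|n0] := posnP n.
rewrite mulnC -leq_divRL //; apply/bigmax_leqP=> H /andP[sH fH].
rewrite leq_divRL //.
have pb p : \sum_(e in H.2) (in_subcube p e : nat) <= exQ n F.
  case: p => i b; apply: (@leq_trans #|(pullback i b H).2|).
    apply: leq_trans (card_pullback i b sH).
    rewrite -sum1_card big_mkcond [leqRHS]big_mkcond /=.
    by apply: leq_sum => e _; rewrite inE; case: (e \in H.2); case: in_subcube.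
  rewrite /exQ /ex_num; apply: (bigop.bigmax_sup (pullback i b H)) => //.
  rewrite pullback_subgraph //=; apply: contra fH; exact: pullback_copy.
have -> : (2 * n.+1 * exQ n F = \sum_(p : 'I_n.+1 * bool) exQ n F)%N.
  by rewrite sum_nat_const card_prod card_ord card_bool [(n.+1 * 2)%N]mulnC.
apply: (@leq_trans (\sum_(p : 'I_n.+1 * bool) \sum_(e in H.2) (in_subcube p e : nat))).
  rewrite exchange_big /= -sum_nat_const; apply: leq_sum => e eH.
  case/andP: sH => /fintype.subsetP/(_ _ eH)/card_in_subcube le _.
  apply: leq_trans le _; rewrite -sum1_card big_mkcond /=.
  by apply: leq_sum => p _; rewrite inE; case: in_subcube.
by apply: leq_sum => p _; apply: pb.
Qed.

End Averaging.

Local Open Scope ring_scope.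
Local Open Scope classical_set_scope.

Lemma exQ_ratio_ge0 (R : realType) F n : 0 <= exQ_ratio R F n.
Proof. by rewrite divr_ge0 ?ler0n. Qed.

Lemma exQ_ratio_nonincreasing (R : realType) F n :
  (0 < n)%N -> exQ_ratio R F n.+1 <= exQ_ratio R F n.
Proof.
case: n => // m _; rewrite /exQ_ratio /=.
rewrite ler_pdivrMr ?ltr0n ?muln_gt0 ?expn_gt0 //.
rewrite mulrAC ler_pdivlMr ?ltr0n ?muln_gt0 ?expn_gt0 //.
rewrite -!natrM ler_nat expnS.
have := leq_mul (exQ_average m.+1 F) (leqnn (2 ^ m)).
by rewrite !mulnA [(exQ _ _ * m.+1)%N]mulnC [(exQ _ _ * m.+2 * 2)%N]mulnAC
  -[(exQ _ _ * 2 * _)%N]mulnA [(exQ m.+1 F * _)%N]mulnC.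
Qed.

Lemma exQ_ratio_cvg (R : realType) F : cvgn (exQ_ratio R F).
Proof.
have cS : cvgn (fun n => exQ_ratio R F n.+1).
  apply: nonincreasing_is_cvgn.
    by apply/nonincreasing_seqP => n; apply: exQ_ratio_nonincreasing.
  by exists 0 => _ [n _ <-]; apply: exQ_ratio_ge0.
apply/cvg_ex; exists (limn (fun n => exQ_ratio R F n.+1)).
by rewrite -cvg_shiftS; exact: cS.
Qed.

(* Main.v *)
From Stdlib Require Import ZArith.
Require Import Defs.
From mathcomp Require Import all_boot all_order all_algebra.
From mathcomp Require Import reals.
From mathcomp Require Import topology normedtype sequences.
From mathcomp Require Import ssrZ zify ring lra.

(** Razborov's flag algebra method on 3-dimensional subcubes. For every vertex x and
    direction i, and every function psi of the 2-dimensional subcubes through the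
    edge (x, i), the sum of psi(x, i, j) psi(x, i, k) over j <> k is a square minus
    its diagonal terms, hence nonnegative up to an error linear in n. On the other
    hand, for four well-chosen psi's, every one of the finitely many C_4-free
    configurations on a 3-cube satisfies: the number of its edges plus the sum over
    the 12 edges of the products of the psi's on the two incident faces is at most
    12 * 0.6068. Summing over all 3-subcubes, the products contribute at least
    -O(1/n) to the average, which bounds the edge density by 0.6068 + O(1/n). *)

Set Implicit Arguments.
Unset Strict Implicit.
Unset Printing Implicit Defensive.

Import Order.TTheory GRing.Theory Num.Theory.

(** * The integer certificate on the 3-cube *)

Section Certificate.
Local Open Scope Z_scope.

(* A flag is a 2-dimensional subcube through a marked edge (x, x + e_i), which is
   present or not according to [e]: [p] and [q] record the edges in the other
   direction j at x and at x + e_i, and [r] the edge opposite to the marked one.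
   Exchanging x and x + e_i swaps [p] and [q]; the functions below are
   eigenfunctions of this swap. *)
Definition odd_flag (u v : Z) (p q r : bool) : Z :=
  match p, q with
  | true, false => if r then v else u
  | false, true => - (if r then v else u)
  | _, _ => 0
  end.

Definition even_flag (s0 s1 s2 t0 t1 t2 : Z) (p q r : bool) : Z :=
  match p, q with
  | false, false => if r then t0 else s0
  | true, true => if r then t2 else s2
  | _, _ => if r then t1 else s1
  end.

(* The coefficients, in units of 1/10000, are a rounded factorization of the optimal
   solution of the flag-algebra semidefinite program, whose value is 0.606794...
   The final 0 is arbitrary: it belongs to a subcube with all four edges. *)
Definition psi0 (e : bool) :=
  if e then odd_flag 9098 3438 else odd_flag 12480 7313.

Definition psi1 (e : bool) :=
  if e then odd_flag (-1) 1934 else odd_flag 0 4844.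

Definition psi2 (e : bool) :=
  if e then even_flag 13027 2210 (-9419) 347 3041 0
  else even_flag (-7703) 6110 8213 (-3496) 3023 (-1250).

Definition psi3 (e : bool) :=
  if e then even_flag (-7) 37 367 4840 (-284) 0
  else even_flag (-1159) (-1950) (-9) (-2142) (-1226) 2210.

(* [scale] is 10000 ^ 2 and [target / scale = 6068 / 10000 = 1517 / 2500]; the common
   factor is split off because naturals up to 2500 are still cheap in unary. *)
Definition grain : Z := 40000.

Definition scale : Z := 2500 * grain.

Definition target : Z := 1517 * grain.

(** Both flags share the marked edge. The product terms are the positive semidefinite form of the
    flag-algebra program, written as a sum of rank-one squares. *)
Definition weight (e p q r p' q' r' : bool) : Z :=
  (if e then scale else 0)
  + (psi0 e p q r * psi0 e p' q' r' + psi1 e p q r * psi1 e p' q' r'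
     + psi2 e p q r * psi2 e p' q' r' + psi3 e p q r * psi3 e p' q' r').

(* [I a b] is the edge in direction i at x + a e_j + b e_k; [J] and [K] are obtained
   by cyclically permuting (i, j, k). *)
Definition dir_weight (I J K : bool -> bool -> bool) : Z :=
  let w a b := weight (I a b) (J b false) (J b true) (I (~~ a) b)
                 (K false a) (K true a) (I a (~~ b)) in
  w false false + w false true + (w true false + w true true).

(** These are the two parallel faces spanned by i and j, at offsets 0 and 1 along k. *)
Definition faces_free (I J : bool -> bool -> bool) : bool :=
  ~~ [&& I false false, I true false, J false false & J false true]
  && ~~ [&& I false true, I true true, J true false & J true true].

Definition all_bool (P : bool -> bool) : bool := P false && P true.

Definition all_dir (P : (bool -> bool -> bool) -> bool) : bool :=
  all_bool (fun a => all_bool (fun b => all_bool (fun c => all_bool (fun d =>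
    P (fun s t => if s then (if t then d else c) else (if t then b else a)))))).

Lemma all_boolP P : all_bool P -> forall b, P b.
Proof. by case/andP=> ? ? []. Qed.

(** The table of [f] replaces [f]: a [P] that only evaluates its argument at closed booleans is
    convertible on both, so extensionality is avoided. *)
Lemma all_dirP P : all_dir P -> forall f : bool -> bool -> bool,
  P (fun s t => if s then (if t then f true true else f true false)
                else (if t then f false true else f false false)).
Proof.
move=> H f.
by move: H => /all_boolP/(_ (f false false))/all_boolP/(_ (f false true))
  /all_boolP/(_ (f true false))/all_boolP/(_ (f true true)).
Qed.

Definition cube_check : bool :=
  all_dir (fun I => all_dir (fun J => faces_free I J ==>
    all_dir (fun K => faces_free J K ==> faces_free K I ==>
      (dir_weight I J K + dir_weight J K I + dir_weight K I J
       <=? 12 * target)))).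

Lemma cube_check_true : cube_check.
Proof. by vm_cast_no_check (erefl true). Qed.

Lemma cube_ineq I J K :
  faces_free I J -> faces_free J K -> faces_free K I ->
  dir_weight I J K + dir_weight J K I + dir_weight K I J <= 12 * target.
Proof.
move=> hIJ hJK hKI; apply/Z.leb_le.
have /all_dirP/(_ I)/all_dirP/(_ J)/implyP/(_ hIJ) := cube_check_true.
by move=> /all_dirP/(_ K)/implyP/(_ hJK)/implyP/(_ hKI).
Qed.

(** Bounds the diagonal terms j = k. Any constant would do: each vertex has O(n^2) of them against
    order n^3 triples. *)
Lemma psi_sqr_le e p q r :
  psi0 e p q r * psi0 e p q r + psi1 e p q r * psi1 e p q r
   + psi2 e p q r * psi2 e p q r + psi3 e p q r * psi3 e p q r <= 2 * scale.
Proof. by case: e; case: p; case: q; case: r. Qed.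

End Certificate.

Local Open Scope ring_scope.

(** Restoring the diagonal completes the square of the sum of [f]. *)
Lemma sum_offdiag_ge (R : realDomainType) (I : finType) (P : pred I) (f : I -> R) :
  - \sum_(j | P j) f j ^+ 2 <= \sum_(j | P j) \sum_(k | P k && (k != j)) f j * f k.
Proof.
rewrite -subr_ge0 opprK -big_split /=.
have -> : \sum_(j | P j) (\sum_(k | P k && (k != j)) f j * f k + f j ^+ 2)
    = (\sum_(j | P j) f j) ^+ 2.
  rewrite expr2 mulr_suml; apply: eq_bigr => j Pj.
  by rewrite -mulr_sumr -mulrDr addrC -bigD1.
exact: sqr_ge0.
Qed.

(** * Averaging over vertices and ordered triples of directions *)

Section Averaging.
Variable n : nat.
Notation V := {ffun 'I_n -> bool}.

Definition flip (x : V) (i : 'I_n) : V := [ffun j => x j (+) (j == i)].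

Lemma flipK i : involutive (flip^~ i).
Proof. by move=> x; apply/ffunP=> j; rewrite !ffunE -addbA addbb addbF. Qed.

Lemma flipC x i j : flip (flip x i) j = flip (flip x j) i.
Proof. by apply/ffunP=> k; rewrite !ffunE addbAC. Qed.

Lemma sum_flip (R : nmodType) (i : 'I_n) (F : V -> R) :
  \sum_x F (flip x i) = \sum_x F x.
Proof.
by rewrite [RHS](reindex (flip^~ i)) //; exists (flip^~ i) => x _; apply: flipK.
Qed.

Definition distinct3 (p : 'I_n * 'I_n * 'I_n) : bool :=
  [&& p.1.2 != p.1.1, p.2 != p.1.1 & p.2 != p.1.2].

Lemma sum_distinct3 (R : nmodType) (F : 'I_n -> 'I_n -> 'I_n -> R) :
  \sum_(p | distinct3 p) F p.1.1 p.1.2 p.2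
    = \sum_i \sum_(j | j != i) \sum_(k | (k != i) && (k != j)) F i j k.
Proof. by rewrite pair_big_dep /= pair_big_dep /=; apply: eq_bigl => -[[i j] k]. Qed.

Lemma sum_rotate3 (R : nmodType) (F : 'I_n -> 'I_n -> 'I_n -> R) :
  \sum_(p | distinct3 p) F p.1.2 p.2 p.1.1 = \sum_(p | distinct3 p) F p.1.1 p.1.2 p.2.
Proof.
rewrite [RHS](reindex (fun p => (p.1.2, p.2, p.1.1))) /=; last first.
  by exists (fun p => (p.2, p.1.1, p.1.2)) => -[[i j] k].
apply: eq_bigl => -[[i j] k]; rewrite /distinct3 /=.
by rewrite (eq_sym i j) (eq_sym i k); do 3!case: (_ == _).
Qed.

Lemma card_neq1 (i : 'I_n) : #|[pred j | j != i]| = n.-1.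
Proof. by rewrite -[n in RHS]card_ord -(cardC1 i); apply: eq_card. Qed.

Lemma card_neq2 (i j : 'I_n) : j != i -> #|[pred k | (k != i) && (k != j)]| = n.-2.
Proof.
move=> ji; have := cardC (pred2 i j).
rewrite card2 card_ord eq_sym ji /= add2n => /(congr1 (fun m => m.-2)) /= <-.
by apply: eq_card => k; rewrite !inE negb_or.
Qed.

Lemma sum_const_distinct3 (c : 'I_n -> Z) :
  \sum_(p | distinct3 p) c p.1.1 = (n.-1 * n.-2)%:R * \sum_i c i.
Proof.
rewrite (sum_distinct3 (fun i _ _ => c i)) mulr_sumr; apply: eq_bigr => i _.
rewrite (eq_bigr (fun=> c i *+ n.-2)); last first.
  by move=> j ji; rewrite sumr_const card_neq2.
by rewrite sumr_const card_neq1 -mulrnA mulr_natl mulnC.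
Qed.

Definition parallel_sum (w : V -> 'I_n -> 'I_n -> 'I_n -> Z) x i j k : Z :=
  w x i j k + w (flip x k) i j k
  + (w (flip x j) i j k + w (flip (flip x j) k) i j k).

Lemma sum_parallel_sum w i j k :
  \sum_x parallel_sum w x i j k = (\sum_x w x i j k) *+ 4.
Proof.
rewrite !big_split /=.
rewrite (sum_flip k (fun x => w x i j k)) (sum_flip j (fun x => w x i j k)).
rewrite (sum_flip j (fun x => w (flip x k) i j k)) (sum_flip k (fun x => w x i j k)).
by rewrite -!mulr2n -mulrnA.
Qed.

(** Summed over all x and triples, the three rotations and the four translates each give the same
    total, so the left side becomes 12 times that total. *)
Lemma sum_weight_le w (c : Z) :
  (forall x i j k, i != j -> j != k -> k != i ->
    parallel_sum w x i j k + parallel_sum w x j k i + parallel_sum w x k i j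
    <= 12 * c) ->
  \sum_(p | distinct3 p) \sum_x w x p.1.1 p.1.2 p.2
    <= c * (n * (n.-1 * n.-2) * 2 ^ n)%:R.
Proof.
move=> le_w.
have : \sum_(p | distinct3 p) \sum_(x : V)
    (parallel_sum w x p.1.1 p.1.2 p.2 + parallel_sum w x p.1.2 p.2 p.1.1
     + parallel_sum w x p.2 p.1.1 p.1.2)
    <= \sum_(p | distinct3 p) \sum_(x : V) 12 * c.
  apply: ler_sum => -[[i j] k] /and3P[/= ji ki kj]; apply: ler_sum => x _.
  by apply: le_w; rewrite // eq_sym.
rewrite (eq_bigr (fun p => (\sum_x w x p.1.1 p.1.2 p.2) *+ 4
   + (\sum_x w x p.1.2 p.2 p.1.1) *+ 4 + (\sum_x w x p.2 p.1.1 p.1.2) *+ 4));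
  last by move=> p _; rewrite big_split big_split /= !sum_parallel_sum.
rewrite big_split big_split /= !sumrMnl.
rewrite (sum_rotate3 (fun i j k => \sum_x w x i j k)).
rewrite -(sum_rotate3 (fun i j k => \sum_x w x k i j)).
set T := \sum_(p | _) _.
rewrite (sum_const_distinct3 (fun=> \sum_(x : V) 12 * c)).
rewrite !sumr_const card_ord card_ffun card_bool card_ord.
rewrite -!mulrnDr -[_ *+ _ *+ n]mulrnA -[leLHS]mulr_natr.
rewrite -[_ *+ (2 ^ n * n)]mulr_natr !natrM.
set a := (n.-1)%:R; set b := (n.-2)%:R; set m := n%:R; set d := (2 ^ n)%:R.
have -> : a * b * (12 * c * (d * m)) = c * (m * (a * b) * d) * (4 + 4 + 4)%:R by ring.
by rewrite ler_pM2r.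
Qed.

(** * Weights of a C_4-free edge indicator *)

Variable e : V -> 'I_n -> bool.
Hypothesis e_flip : forall x i, e (flip x i) i = e x i.
Hypothesis e_free : forall x i j, i != j ->
  ~~ [&& e x i, e (flip x j) i, e x j & e (flip x i) j].

(** Such x and y are equal or are the two ends of one edge in direction i. *)
Lemma eq_edge (x y : V) i : (forall l, l != i -> x l = y l) -> e x i = e y i.
Proof.
move=> xy; have [xyi|xyi] := eqVneq (x i) (y i).
  by congr e; apply/ffunP=> l; have [->|/xy] := eqVneq l i.
rewrite -(e_flip y); congr e; apply/ffunP=> l; rewrite ffunE.
have [->|li] := eqVneq l i; last by rewrite addbF xy.
by move: xyi; case: (x i); case: (y i).
Qed.

Definition flag (g : bool -> bool -> bool -> bool -> Z) (x : V) (i j : 'I_n) : Z :=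
  g (e x i) (e x j) (e (flip x i) j) (e (flip x j) i).

Definition edge_weight (x : V) (i j k : 'I_n) : Z :=
  weight (e x i) (e x j) (e (flip x i) j) (e (flip x j) i)
    (e x k) (e (flip x i) k) (e (flip x k) i).

Definition flip_if (b : bool) (x : V) (i : 'I_n) := if b then flip x i else x.

Definition dir_state (x : V) (i j k : 'I_n) (a b : bool) : bool :=
  e (flip_if b (flip_if a x j) k) i.

(** The seven arguments name the same edges from different base points, possibly opposite ends,
    which [eq_edge] identifies. *)
Lemma edge_weight_state x i j k a b :
  edge_weight (flip_if b (flip_if a x j) k) i j k
  = let I := dir_state x i j k in
    let J := dir_state x j k i in
    let K := dir_state x k i j in
    weight (I a b) (J b false) (J b true) (I (~~ a) b)
      (K false a) (K true a) (I a (~~ b)).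
Proof.
rewrite /edge_weight /dir_state /=.
move: weight => w; congr w; apply: eq_edge => l /negbTE li; rewrite /flip_if;
  case: a b => -[]; rewrite /= ?ffunE ?li;
  by case: (l == i); case: (l == j); case: (l == k); case: (x l).
Qed.

Lemma dir_weight_state x i j k :
  dir_weight (dir_state x i j k) (dir_state x j k i) (dir_state x k i j)
  = parallel_sum edge_weight x i j k.
Proof.
have := (edge_weight_state x i j k false false, edge_weight_state x i j k false true,
  edge_weight_state x i j k true false, edge_weight_state x i j k true true).
by rewrite /parallel_sum /flip_if => -[[[-> ->] ->] ->].
Qed.

Lemma cube_state_ineq x i j k : i != j -> j != k -> k != i ->
  dir_weight (dir_state x i j k) (dir_state x j k i) (dir_state x k i j)
  + dir_weight (dir_state x j k i) (dir_state x k i j) (dir_state x i j k)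
  + dir_weight (dir_state x k i j) (dir_state x i j k) (dir_state x j k i)
  <= 12 * target.
Proof.
(* One face is based at [y], the opposite one at [flip y c]. *)
have free y a b c : a != b -> faces_free (dir_state y a b c) (dir_state y b c a).
  move=> ab; rewrite /faces_free /dir_state /flip_if e_free //=.
  by rewrite (flipC y b c) e_free.
move=> ij jk ki; have := cube_ineq (free x _ _ k ij) (free x _ _ i jk) (free x _ _ j ki).
move: target (dir_weight _ _ _) (dir_weight _ _ _) (dir_weight _ _ _); lia.
Qed.

Definition total_weight : Z :=
  \sum_(p | distinct3 p) \sum_x edge_weight x p.1.1 p.1.2 p.2.

Lemma total_weight_le :
  total_weight <= target * (n * (n.-1 * n.-2) * 2 ^ n)%:R.
Proof.
apply: sum_weight_le => x i j k ij jk ki.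
by rewrite -!dir_weight_state; apply: cube_state_ineq.
Qed.

Lemma edge_weightE x i j k :
  edge_weight x i j k = scale * (e x i)%:R
    + (flag psi0 x i j * flag psi0 x i k + flag psi1 x i j * flag psi1 x i k
       + flag psi2 x i j * flag psi2 x i k + flag psi3 x i j * flag psi3 x i k).
Proof.
rewrite /edge_weight /weight /flag.
by case: (e x i); rewrite ?mulr1 ?mulr0.
Qed.

Lemma flag_sqr_le x i j :
  flag psi0 x i j ^+ 2 + flag psi1 x i j ^+ 2 + flag psi2 x i j ^+ 2
    + flag psi3 x i j ^+ 2 <= 2 * scale.
Proof.
have := @psi_sqr_le (e x i) (e x j) (e (flip x i) j) (e (flip x j) i).
rewrite /flag; move: (psi0 _ _ _ _) (psi1 _ _ _ _) (psi2 _ _ _ _) (psi3 _ _ _ _).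
by move: scale; lia.
Qed.

(** For fixed x and i, each of the four flag families gives an off-diagonal sum, at least minus its
    diagonal; the four diagonals together cost at most [2 * scale] per pair (i, j). *)
Lemma vertex_weight_ge x :
  scale * (n.-1 * n.-2 * \sum_i e x i)%:R - 2 * scale * (n * n.-1)%:R
  <= \sum_(p | distinct3 p) edge_weight x p.1.1 p.1.2 p.2.
Proof.
under [leRHS]eq_bigr => p _ do rewrite edge_weightE.
rewrite big_split /= (sum_const_distinct3 (fun i => scale * (e x i)%:R)).
rewrite -mulr_sumr -natr_sum !natrM mulrCA; apply: lerD => //.
rewrite (sum_distinct3 (fun i j k => flag psi0 x i j * flag psi0 x i k
  + flag psi1 x i j * flag psi1 x i k + flag psi2 x i j * flag psi2 x i k
  + flag psi3 x i j * flag psi3 x i k)).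
have -> : - (2 * scale * (n%:R * n.-1%:R)) =
    \sum_(i < n) - \sum_(j | j != i) (2 * scale).
  move: scale => s; under eq_bigr => i _ do rewrite sumr_const card_neq1.
  by rewrite sumr_const card_ord -mulNrn -mulrnA -[RHS]mulr_natr natrM; ring.
apply: ler_sum => i _.
apply: (@le_trans _ _ (- \sum_(j | j != i) (flag psi0 x i j ^+ 2
    + flag psi1 x i j ^+ 2 + flag psi2 x i j ^+ 2 + flag psi3 x i j ^+ 2))).
  by rewrite lerN2; apply: ler_sum => j _; apply: flag_sqr_le.
rewrite !big_split /= !opprD.
under [leRHS]eq_bigr => j _ do rewrite !big_split /=.
by rewrite !big_split /=; do 3?[apply: lerD]; apply: sum_offdiag_ge.
Qed.

Lemma edge_density :
  scale * (n.-1 * n.-2 * \sum_x \sum_i e x i)%:R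
    <= target * (n * (n.-1 * n.-2) * 2 ^ n)%:R + 2 * scale * (n * n.-1 * 2 ^ n)%:R.
Proof.
rewrite -lerBlDr; apply: le_trans total_weight_le.
rewrite /total_weight [leRHS]exchange_big /=.
apply: (@le_trans _ _ (\sum_(x : V) (scale * (n.-1 * n.-2 * \sum_i e x i)%:R
    - 2 * scale * (n * n.-1)%:R))); last first.
  by apply: ler_sum => x _; apply: vertex_weight_ge.
rewrite sumrB sumr_const card_ffun card_bool card_ord -mulr_sumr -natr_sum.
by rewrite -big_distrr /= (natrM _ (n * n.-1)) mulrA [_ * (2 ^ n)%:R]mulr_natr.
Qed.

End Averaging.

(** * From subgraphs of the cube to edge indicators *)

Section CubeSubgraph.
Variables (n : nat) (H : {set hypercube n} * {set {set hypercube n}}).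
Hypothesis subH : is_subgraph H.
Notation V := {ffun 'I_n -> bool}.

Definition in_dir (x : V) (i : 'I_n) : bool := [set x; flip x i] \in H.2.

Lemma in_dir_flip x i : in_dir (flip x i) i = in_dir x i.
Proof. by rewrite /in_dir flipK setUC. Qed.

Lemma in_dir_C4_free : ~~ has_copy (cycle_graph 4) H ->
  forall x i j, i != j ->
  ~~ [&& in_dir x i, in_dir (flip x j) i, in_dir x j & in_dir (flip x i) j].
Proof.
move=> noC4 x i j ij; apply: contra noC4 => /and4P[xi xji xj xij].
(* The corners of the face in cyclic order; coordinates i and j tell them apart. *)
pose f : {ffun 'I_4 -> V} :=
  [ffun u : 'I_4 => nth x [:: x; flip x i; flip (flip x i) j; flip x j] u].
have fE : [/\ [set x; flip x i] \in H.2, [set flip x i; flip (flip x i) j] \in H.2,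
    [set flip (flip x i) j; flip x j] \in H.2 & [set flip x j; x] \in H.2].
  by split=> //; rewrite ?(flipC x i j) setUC.
apply/existsP; exists f; apply/and3P; split.
- apply/injectiveP => u v; rewrite !ffunE => /ffunP fuv.
  have [ijF jiF] : (i == j) = false /\ (j == i) = false.
    by rewrite [j == i]eq_sym (negbTE ij).
  move: (fuv i) (fuv j) => {fuv}.
  by case: u => -[|[|[|[|//]]]] ?; case: v => -[|[|[|[|//]]]] ?;
    rewrite /= ?ffunE ?eqxx ?ijF ?jiF; case: (x i); case: (x j) => //= *; apply: val_inj.
- have /andP[_ /forall_inP sub] := subH.
  have edgeV A y : A \in H.2 -> y \in A -> y \in H.1.
    by move=> /sub/subsetP; apply.
  apply/forallP => u; rewrite ffunE.
  by case: u => -[|[|[|[|//]]]] ? /=; case: fE => h1 h2 h3 h4;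
    [apply: edgeV h1 _|apply: edgeV h1 _|apply: edgeV h2 _|apply: edgeV h4 _];
    rewrite !inE eqxx ?orbT.
- apply/forallP => u; apply/forallP => v; apply/implyP; rewrite !ffunE.
  case: fE => h1 h2 h3 h4.
  by case: u => -[|[|[|[|//]]]] ? /=; case: v => -[|[|[|[|//]]]] ? //= _ //;
    rewrite setUC.
Qed.

(** Double counting: an edge with ends x, y in direction d is counted at (x, d) and at (y, d). *)
Lemma card_edges_le : (2 * #|H.2| <= \sum_x \sum_i in_dir x i)%N.
Proof.
rewrite pair_big /=.
have -> : (\sum_(p : V * 'I_n) in_dir p.1 p.2
    = \sum_(p : V * 'I_n) \sum_(A in H.2) (A == [set p.1; flip p.1 p.2]))%N.
  apply: eq_bigr => p _; rewrite /in_dir; case: (boolP (_ \in _)) => pH.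
    rewrite (bigD1 [set p.1; flip p.1 p.2]) //= eqxx big1 // => A /andP[_ /negbTE ->] //.
  by rewrite big1 // => A AH; case: eqP => // AE; rewrite -AE AH in pH.
rewrite exchange_big /= mulnC -sum_nat_const; apply: leq_sum => A AH.
have /andP[/subsetP/(_ _ AH) + _] := subH.
rewrite inE => /existsP[x /existsP[y /andP[/= /cards1P[d dxy] /eqP ->]]].
have yE : y = flip x d.
  apply/ffunP => l; rewrite ffunE; move/setP/(_ l): dxy; rewrite !inE.
  by case: (l == d); case: (x l); case: (y l).
have yx : y != x.
  by apply/eqP => yx; move/setP/(_ d): dxy; rewrite yx !inE !eqxx.
rewrite (bigD1 (x, d)) //= (bigD1 (y, d)) /=; last by rewrite xpair_eqE (negbTE yx).
by rewrite -yE eqxx yE flipK setUC eqxx.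
Qed.

End CubeSubgraph.

(** Equivalently, the edge ratio is at most 1517/2500 + 2/(n - 2): the factor [grain * (n - 1)]
    cancels from [edge_density]. *)
Lemma exQ_C4_le n : (2 < n)%N ->
  (exQ n (cycle_graph 4) * (2500 * 2 * n.-2)
   <= (1517 * n.-2 + 2500 * 2) * (n * 2 ^ n))%N.
Proof.
move=> n2; have pos : (0 < 2500 * 2 * n.-2)%N by lia.
rewrite -leq_divRL //; apply/bigmax_leqP => H /andP[sH fH].
rewrite leq_divRL // -(ler_nat Z).
have := edge_density (in_dir_flip H) (in_dir_C4_free sH fH).
have := card_edges_le sH; rewrite -(ler_nat Z) natrM.
move: (\sum_x _)%N => S leS.
have -> : scale = 2500%:R * grain by [].
have -> : target = 1517%:R * grain by [].
have n1 : 0 < n.-1%:R :> Z by rewrite ltr0n; lia.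
have g0 : 0 < grain by [].
have u0 : 0 <= 2500%:R :> Z by [].
have b0 : 0 <= n.-2%:R :> Z by [].
rewrite !(natrM, natrD).
move: grain (2500%:R) (1517%:R) (n.-1)%:R (n.-2)%:R (n%:R) ((2 ^ n)%:R) (S%:R)
  (#|H.2|%:R) g0 u0 b0 n1 leS => g u v a b m d s h g0 u0 b0 n1 leS leT.
rewrite -(ler_pM2l (mulr_gt0 g0 n1)).
have -> : g * a * ((v * b + u * 2) * (m * d))
    = v * g * (m * (a * b) * d) + 2 * (u * g) * (m * a * d) by ring.
apply: le_trans leT.
have -> : g * a * (h * (u * 2 * b)) = u * g * (a * b * (2 * h)) by ring.
by rewrite ler_wpM2l ?ler_wpM2l // ?mulr_ge0 // ltW.
Qed.

(** * Passage to the limit *)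

Theorem theorem1 (R : realType) : piQ R (cycle_graph 4) <= 6068 / 10000.
Proof.
apply/ler_addgt0Pr => eps eps0.
apply: limr_le; first exact: exQ_ratio_cvg.
(* For n = m + 3 with m >= N, the error 2/(n - 2) = 2/(m + 1) is below [eps]. *)
pose N := Num.bound (2 / eps).
exists N.+3 => // -[|[|[|m]]] //= Nm.
have hb : 2 / eps < m.+1%:R.
  apply: lt_le_trans (archi_boundP _) _; first by rewrite divr_ge0 // ltW.
  by rewrite ler_nat; lia.
rewrite ltr_pdivrMr // in hb.
have := @exQ_C4_le m.+3 isT; rewrite /exQ_ratio /= expnS.
have : (0 < 2 ^ m.+2)%N by rewrite expn_gt0.
move: (exQ _ _) (2 ^ m.+2)%N => E d d0.
rewrite -(ler_nat R) ler_pdivrMr ?ltr0n ?muln_gt0 // => h.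
have -> : 6068 / 10000 = 1517%:R / 2500%:R :> R by lra.
have a0 : 0 < m.+1%:R :> R by [].
have u0 : 0 < 2500%:R :> R by [].
have w0 : 0 <= m.+3%:R * (2 * d%:R) :> R by rewrite !mulr_ge0.
move: h; rewrite !(natrM, natrD).
move: (2500%:R) (1517%:R) (m.+1)%:R (m.+3)%:R (d%:R) (E%:R) u0 a0 w0 hb
  => u v a b D X u0 a0 w0 hb h.
rewrite -(@ler_pM2r _ (u * 2 * a)) ?mulr_gt0 //; apply: le_trans h _.
have -> : (v / u + eps) * (b * D) * (u * 2 * a)
    = (v * a + u * (a * eps)) * (b * (2 * D)) by field; rewrite gt_eqF.
by rewrite ler_wpM2r // lerD2l ler_wpM2l // ltW.
Qed.
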